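(* Let $d\ge1$, let $\|\cdot\|$ be a norm on $\mathbb{R}^d$, and let $p,\eta>0$. (a) There exists a real constant $C_{d,p,\eta}>0$ such that, for every $n\ge1$ and every $\mathbb{R}^d$-valued random vector $X\in L^{p+\eta}(\mathbb{P})$, $$\bar d_{n,p}(X)\le C_{d,p,\eta}\,\sigma_{p+\eta,\|\cdot\|}(X)\,n^{-1/d},$$ where $\sigma_{p+\eta,\|\cdot\|}(X)=\inf_{a\in\mathbb{R}^d}\|X-a\|_{L^{p+\eta}}$ denotes the $L^{p+\eta}$-pseudo-standard deviation of $X$. (b) If the support of the distribution $\mathbb{P}_X$ of the $\mathbb{R}^d$-valued random vector $X$ is compact, then there exists a real constant $C'_{d,p,\eta}>0$ such that, for every $n\ge1$, $$d_{n,p}(X)\le C'_{d,p,\eta}\,\operatorname{diam}_{\|\cdot\|}(\operatorname{supp}(\mathbb{P}_X))\,n^{-1/d}.$$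
   Context: $\mathbb{R}^d$ carries the fixed norm $\|\cdot\|$ (constants may depend on it). $\|Y\|_{L^q}=(\mathbb{E}\|Y\|^q)^{1/q}$, and $X\in L^q(\mathbb{P})$ means $\mathbb{E}\|X\|^q<\infty$. $\operatorname{diam}_{\|\cdot\|}(A)=\sup_{x,y\in A}\|x-y\|$; $\operatorname{conv}$ is the convex hull, $|\Gamma|$ the cardinality, $\operatorname{supp}$ the support of a distribution. A grid is a nonempty finite subset $\Gamma\subset\mathbb{R}^d$. Local dual quantization error: for $\xi\in\mathbb{R}^d$, $$F_p(\xi;\Gamma)=\inf\Big\{\Big(\sum_{x\in\Gamma}\lambda_x\|\xi-x\|^p\Big)^{1/p}:\ \lambda_x\in[0,1],\ \sum_{x\in\Gamma}\lambda_x x=\xi,\ \sum_{x\in\Gamma}\lambda_x=1\Big\},$$ with $\inf\emptyset=+\infty$. Extended local error: $\bar F_p(\xi;\Gamma)=F_p(\xi;\Gamma)$ if $\xi\in\operatorname{conv}(\Gamma)$ and $\bar F_p(\xi;\Gamma)=\operatorname{dist}(\xi,\Gamma)=\min_{x\in\Gamma}\|\xi-x\|$ otherwise. Mean errors, the infima being over grids $\Gamma$: $$d_{n,p}(X)=\inf_{|\Gamma|\le n}(\mathbb{E}[F_p(X;\Gamma)^p])^{1/p},\qquad \bar d_{n,p}(X)=\inf_{|\Gamma|\le n}(\mathbb{E}[\bar F_p(X;\Gamma)^p])^{1/p}.$$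
   Formalization: In (b) the bound is stated for n ≥ d+1, and for n ≤ d only when d_{n,p}(X) < +∞: otherwise it fails, e.g. d = 1, n = 1, X uniform on {0,1} gives d_{1,p}(X) = +∞ while the right-hand side is finite. *)

(* Defs.v *)
(* MathComp-Analysis.  R^d is 'rV[R]_d with its canonical topology, which is the
   one induced by any norm; the norm of the statement is an arbitrary function
   satisfying [is_norm], unrelated to the canonical sup norm on matrices. *)
From HB Require Import structures.
From mathcomp Require Export all_boot all_order all_algebra.
From mathcomp Require Export finmap.
From mathcomp Require Export all_classical all_reals all_analysis.

Set Implicit Arguments.
Unset Strict Implicit.
Unset Printing Implicit Defensive.

Export Order.TTheory GRing.Theory Num.Theory.
Export numFieldNormedType.Exports.

Local Open Scope classical_set_scope.
Local Open Scope ring_scope.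

Record is_norm (R : realType) (d : nat) (N : 'rV[R]_d -> R) : Prop := IsNorm {
  norm_triangle : forall x y, N (x + y) <= N x + N y;
  norm_homog : forall (a : R) x, N (a *: x) = `|a| * N x;
  norm_definite : forall x, N x = 0 -> x = 0
}.

(* R^d with its Borel sigma-algebra. *)
Definition borel_rV (R : realType) (d : nat) :=
  g_sigma_algebraType (@open 'rV[R]_d).

Section Sets.
Context {R : realType} {d : nat}.
Implicit Types (N : 'rV[R]_d -> R) (A : set 'rV[R]_d).

Definition conv A : set 'rV[R]_d :=
  [set x | forall B : set 'rV[R]_d, convex_set B -> A `<=` B -> B x].

(* The diameter is extended-real valued; it is -oo on the empty set. *)
Definition diam N A : \bar R :=
  ereal_sup [set (N (xy.1 - xy.2))%:E | xy in A `*` A].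

Definition supp (mu : set (borel_rV R d) -> \bar R) : set 'rV[R]_d :=
  [set x | forall U : set 'rV[R]_d, open U -> U x -> (0 < mu U)%E].

End Sets.

Section DualQuantization.
Context {R : realType} {d : nat}.
Variables (N : 'rV[R]_d -> R) (p : R).
Implicit Types (G : {fset 'rV[R]_d}) (xi : 'rV[R]_d).

(* The weights are functions on R^d of which only the values on G matter. *)
Definition bary_weights G xi : set ('rV[R]_d -> R) :=
  [set lam | [/\ forall x, x \in G -> 0 <= lam x <= 1,
                 \sum_(x <- G) lam x *: x = xi &
                 \sum_(x <- G) lam x = 1]].

(* ereal_inf set0 = +oo *)
Definition dual_error G xi : \bar R :=
  ereal_inf [set ((\sum_(x <- G) lam x * N (xi - x) `^ p) `^ p^-1)%:E
            | lam in bary_weights G xi].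

Definition dist_grid G xi : \bar R :=
  ereal_inf [set (N (xi - x))%:E | x in [set` G]].

Definition ext_dual_error G xi : \bar R :=
  if `[< conv [set` G] xi >] then dual_error G xi else dist_grid G xi.

Definition grids (n : nat) : set {fset 'rV[R]_d} :=
  [set G | G != fset0 /\ (#|` G| <= n)%N].

Context {disp : measure_display} {T : measurableType disp}.
Variables (P : probability T R) (X : T -> 'rV[R]_d).

Definition mean_dual_error (n : nat) : \bar R :=
  ereal_inf [set Lnorm P p%:E (fun w => dual_error G (X w)) | G in grids n].

Definition mean_ext_dual_error (n : nat) : \bar R :=
  ereal_inf [set Lnorm P p%:E (fun w => ext_dual_error G (X w)) | G in grids n].

End DualQuantization.

Definition pseudo_std {R : realType} {d : nat} (N : 'rV[R]_d -> R) (q : R)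
    {disp : measure_display} {T : measurableType disp} (P : probability T R)
    (X : T -> 'rV[R]_d) : \bar R :=
  ereal_inf (range (fun a => Lnorm P q%:E (fun w => (N (X w - a))%:E))).

(* Main.v *)
Require Import Defs.
From mathcomp Require Import ring lra zify measurable_realfun.

(** Neither part needs random quantization: explicit grids work.

    Everything rests on one remark ([dual_error_le]): if [xi] is a barycenter of
    grid points lying within [rho] of it, then its dual quantization error is at
    most [rho].  A point of a cube divided into equal cells is a barycenter of
    the vertices of its cell, by multilinear interpolation
    ([cube_node_barycenter]), so no triangulation is needed and the error is of
    the order of the side of the cell.

    For (a), put [e = eta / p], fix a center [a] and a scale
    [s > ||X - a||_(p+eta)], and take the union over [j <= J] of the regular
    grids with [2^(J-j)] cells per side on the concentric cubes of half side
    [s 2^(j/e)].  The numbers of points decrease geometrically, so the total is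
    at most [(4 2^J)^d] ([card_layer_index]).  With [t = |x - a| / s], the
    smallest cube containing [x] has cells of side of order
    [s 2^(-J) (1 + t^(1+e))], and outside the largest cube the distance to the
    grid, which is the extended error there, obeys the same bound because then
    [t^e > 2^J] ([layered_grid_ext_error]).  As [p (1 + e) = p + eta], the
    [p]-th power of this bound is integrable and its integral is controlled by
    [s^p 2^(-J p)].  Taking [2^J] of order [n^(1/d)] and then letting [s]
    decrease to the pseudo-standard deviation gives (a); for [n < 4^d] one point
    suffices.

    For (b), the law of [X] is carried by a ball of radius of order the diameter
    of the support around one of its points, which is covered by the innermost
    layer of the same grid when [n >= 4^d].  For [n < 4^d] only a grid of at
    most [n] points whose hull carries the law and whose size is comparable with
    the diameter is needed.  If [n > d] a simplex in R^d will do.  If [n <= d],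
    finiteness of the mean error forces the law to be carried by an affine
    subspace of dimension [k < n] ([affine_support]), and a simplex with [k + 1]
    vertices is built there.  Its size must not depend on the position of the
    subspace: this is what [bounded_row_basis] provides.

    The errors are never shown to be measurable functions of the sample: the
    integral of a nonnegative function is a supremum over the simple functions
    below it, so it is monotone in any case ([le_lower_integral]). *)

Set Implicit Arguments.
Unset Strict Implicit.
Unset Printing Implicit Defensive.

Local Open Scope classical_set_scope.
Local Open Scope ring_scope.

(** * The norm and the sup norm *)

Section NormFacts.
Context {R : realType} {d : nat}.
Implicit Types (x y : 'rV[R]_d) (r : R).

Lemma rV_norm_le x r : 0 <= r -> (`|x| <= r) <-> (forall i, `|x 0 i| <= r).
Proof.
move=> r0; have -> : (`|x| : R) = mx_norm x by []; rewrite mx_normrE; split.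
  move=> /bigmax_leP[_ h] i; exact: (h (0, i)).
by move=> h; apply/bigmax_leP; split => // -[i j] _ /=; rewrite (ord1 i).
Qed.

Lemma rV_coord_le x i : `|x 0 i| <= `|x|.
Proof. exact: (rV_norm_le x (normr_ge0 x)).1. Qed.

Context {N : 'rV[R]_d -> R} (hN : is_norm N).

Lemma is_norm0 : N 0 = 0.
Proof. by rewrite -(scale0r 0) (norm_homog hN) normr0 mul0r. Qed.

Lemma is_normN x : N (- x) = N x.
Proof. by rewrite -scaleN1r (norm_homog hN) normrN1 mul1r. Qed.

Lemma is_normB x y : N (x - y) = N (y - x).
Proof. by rewrite -is_normN opprB. Qed.

Lemma is_norm_ge0 x : 0 <= N x.
Proof.
have := norm_triangle hN x (- x).
by rewrite subrr is_norm0 is_normN -mulr2n pmulrn_lge0.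
Qed.

Lemma is_norm_sum (I : Type) (s : seq I) (F : I -> 'rV[R]_d) :
  N (\sum_(i <- s) F i) <= \sum_(i <- s) N (F i).
Proof.
elim/big_ind2 : _ => //; first by rewrite is_norm0.
by move=> a b c e ab ce; apply: (le_trans (norm_triangle hN _ _)); exact: lerD.
Qed.

(** Half of the equivalence of [N] with the sup norm. *)
Lemma is_norm_le_sup : exists2 c : R, 0 < c & forall x, N x <= c * `|x|.
Proof.
exists (1 + \sum_i N (delta_mx 0 i)) => [|x].
  by rewrite ltr_pwDl// sumr_ge0// => i _; exact: is_norm_ge0.
rewrite {1}[x]row_sum_delta (le_trans (is_norm_sum _ _))//.
rewrite mulrDl mul1r mulr_suml ler_wpDl// ler_sum// => i _.
by rewrite (norm_homog hN) mulrC ler_wpM2l ?is_norm_ge0 ?rV_coord_le.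
Qed.

Lemma is_norm_continuous : continuous N.
Proof.
have [c c0 hc] := is_norm_le_sup.
move=> x; apply/(@cvgrPdist_le _ _ _ (nbhs x) (nbhs_filter x)) => /= e e0.
have ec : 0 < e / c by rewrite divr_gt0.
apply/nbhs_ballP; exists (e / c) => //= y; rewrite -ball_normE /ball_ /= => xyc.
have xy : N (x - y) <= e.
  by rewrite (le_trans (hc _))// mulrC -ler_pdivlMr// ltW.
have h1 := norm_triangle hN (x - y) y.
have h2 := norm_triangle hN (y - x) x.
rewrite !subrK in h1 h2; rewrite (is_normB y x) in h2.
by rewrite ler_norml; apply/andP; split; lra.
Qed.

Lemma is_norm_shift_continuous (a : 'rV[R]_d) :
  continuous (fun x : 'rV[R]_d => N (x - a)).
Proof.
move=> x; apply: (@cvg_comp _ _ _ (fun x : 'rV[R]_d => x - a) N _ (nbhs (x - a))).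
  apply: (@cvgB _ _ _ (nbhs x) (nbhs_filter x)); first exact: cvg_id.
  exact: cvg_cst.
exact: is_norm_continuous.
Qed.

(** The other half: [N] attains a positive minimum on the compact sup-norm
    unit sphere. *)
Lemma sup_le_is_norm : exists2 c : R, 0 < c & forall x, `|x| <= c * N x.
Proof.
pose S := [set x : 'rV[R]_d | `|x| = 1].
have cS : compact S.
  apply: bounded_closed_compact.
    by exists 1; split => // M M1 x /= ->; exact: ltW.
  rewrite [S](_ : _ = (fun x : 'rV[R]_d => `|x|) @^-1` [set 1])//.
  apply: closed_comp; last exact: closed_eq.
  by move=> x _; exact: norm_continuous.
have [S0|] := pselect (S !=set0); last first.
  move=> S0; exists 1 => // x.
  have [->|x0] := eqVneq x 0; first by rewrite normr0 mul1r is_norm_ge0.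
  exfalso; apply: S0; exists (`|x|^-1 *: x).
  by rewrite /S /= normrZ normfV normr_id mulVf ?normr_eq0.
have cf : {within S, continuous N}.
  by apply: continuous_subspaceT; exact: is_norm_continuous.
have [m Sm hm] : exists2 m, S m & forall y, S y -> N m <= N y.
  have [m [/set_mem Sm hm]] := compact_EVT_min S0 cS cf.
  by exists m => // y Sy; apply: hm; rewrite inE.
have Nm : 0 < N m.
  rewrite lt0r is_norm_ge0 andbT; apply/eqP => /(norm_definite hN) m0.
  by move: Sm; rewrite /S/= m0 normr0 => /eqP; rewrite eq_sym oner_eq0.
exists (N m)^-1; first by rewrite invr_gt0.
move=> x; have [->|x0] := eqVneq x 0.
  by rewrite normr0 is_norm0 mulr0.
have nx : 0 < `|x| by rewrite normr_gt0.
have := hm (`|x|^-1 *: x).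
rewrite /S/= normrZ normfV normr_id mulVf ?normr_eq0// => /(_ erefl).
rewrite (norm_homog hN) normfV normr_id => h.
by rewrite mulrC ler_pdivlMr// mulrC -ler_pdivlMr// mulrC.
Qed.

End NormFacts.

(** * Local errors and barycenters *)

Lemma sum_fiber_fset (V : nmodType) (I : finType) (K : choiceType)
    (G : {fset K}) (v : I -> K) (F : I -> V) :
  (forall i, v i \in G) ->
  \sum_(x <- G) \sum_(i | v i == x) F i = \sum_i F i.
Proof.
move=> vG; under eq_bigr do rewrite big_mkcond/=.
rewrite exchange_big/=; apply: eq_bigr => i _.
rewrite -big_mkcond/=.
rewrite -[RHS](fbig_pred1_inj (f := fun=> F i) (op := +%R) _ _ (vG i) (@inj_id _)).
by apply: eq_bigl => x /=; rewrite eq_sym.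
Qed.

Local Open Scope convex_scope.

Section DualError.
Context {R : realType} {d : nat} {N : 'rV[R]_d -> R} (hN : is_norm N).
Context {p : R} (hp : 0 < p).
Implicit Types (G : {fset 'rV[R]_d}) (x xi : 'rV[R]_d).

Lemma dual_error_ge0 G xi : (0 <= dual_error N p G xi)%E.
Proof.
apply: le_ereal_inf_tmp => _ [lam _ <-].
by rewrite lee_fin powR_ge0.
Qed.

Lemma dist_grid_ge0 G xi : (0 <= dist_grid N G xi)%E.
Proof.
apply: le_ereal_inf_tmp => _ [lam _ <-].
by rewrite lee_fin (is_norm_ge0 hN).
Qed.

Lemma ext_dual_error_ge0 G xi : (0 <= ext_dual_error N p G xi)%E.
Proof.
rewrite /ext_dual_error; case: ifP => _; [exact: dual_error_ge0|exact: dist_grid_ge0].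
Qed.

(** Any representation of [xi] as a barycenter of a finite family of grid
    points at distance at most [rho] bounds the local error by [rho]; the
    family may repeat points. *)
Lemma dual_error_le (I : finType) (v : I -> 'rV[R]_d) (w : I -> R) G xi rho :
  (forall i, v i \in G) -> (forall i, 0 <= w i) -> \sum_i w i = 1 ->
  \sum_i w i *: v i = xi -> (forall i, N (xi - v i) <= rho) ->
  (dual_error N p G xi <= rho%:E)%E.
Proof.
move=> vG w0 w1 wxi vrho.
have rho0 : 0 <= rho.
  have [i _|I0] := pickP (fun i : I => true).
    by apply: le_trans (vrho i); exact: is_norm_ge0.
  by move: w1 => /eqP; rewrite big_pred0// eq_sym oner_eq0.
(* A point of the grid collects the weights of its occurrences in [v]. *)
pose lam x := \sum_(i | v i == x) w i.
have lam0 x : 0 <= lam x by apply: sumr_ge0 => i _.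
have slam : \sum_(x <- G) lam x = 1 by rewrite sum_fiber_fset.
apply: ereal_inf_le; exists (((\sum_(x <- G) lam x * N (xi - x) `^ p) `^ p^-1)%:E).
  exists lam => //; split => //.
    move=> x xG; rewrite lam0/= -slam [leRHS](big_fsetD1 x)//= lerDl.
    by apply: sumr_ge0 => i _.
  rewrite -[RHS]wxi -(sum_fiber_fset _ vG); apply: eq_bigr => x _.
  by rewrite scaler_suml; apply: eq_bigr => i /eqP ->.
rewrite lee_fin.
have -> : rho = (rho `^ p) `^ p^-1 by rewrite -powRrM divff ?gt_eqF// powRr1.
apply: ge0_ler_powR; rewrite ?invr_ge0 ?nnegrE ?powR_ge0 ?(ltW hp)//.
  by apply: sumr_ge0 => x _; rewrite mulr_ge0 ?powR_ge0.
rewrite -(mul1r (rho `^ p)) -slam mulr_suml; apply: ler_sum => x _.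
rewrite /lam !mulr_suml ler_sum// => i /eqP <-.
by rewrite ler_wpM2l// ge0_ler_powR ?nnegrE ?(ltW hp)// is_norm_ge0.
Qed.

Lemma dist_grid_le G xi x : x \in G -> (dist_grid N G xi <= (N (xi - x))%:E)%E.
Proof. by move=> xG; apply: ereal_inf_lbound; exists x. Qed.

(** The bound of [dual_error_le] holds for the extended error without having to
    know whether [xi] lies in the convex hull. *)
Lemma ext_dual_error_le (I : finType) (v : I -> 'rV[R]_d) (w : I -> R) G xi rho :
  (forall i, v i \in G) -> (forall i, 0 <= w i) -> \sum_i w i = 1 ->
  \sum_i w i *: v i = xi -> (forall i, N (xi - v i) <= rho) ->
  (ext_dual_error N p G xi <= rho%:E)%E.
Proof.
move=> vG w0 w1 wxi vrho; rewrite /ext_dual_error; case: ifP => _.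
  exact: dual_error_le wxi vrho.
have [i _|I0] := pickP (fun i : I => true); last first.
  by move: w1 => /eqP; rewrite big_pred0// eq_sym oner_eq0.
by apply: (le_trans (dist_grid_le xi (vG i))); rewrite lee_fin.
Qed.

(** The cube of center [a] and half side [r]: a closed ball of the sup norm,
    reduced to [a] for [r = 0]. *)
Definition cube (a : 'rV[R]_d) (r : R) : set 'rV[R]_d :=
  [set x | `|x - a| <= r].

Lemma cube_convex a r : convex_set (cube a r).
Proof.
move=> x y l; rewrite !inE /cube/= => xa ya.
have -> : x <| l |> y - a = l%:num *: (x - a) + (1 - l%:num) *: (y - a).
  have -> : x <| l |> y = l%:num *: x + (1 - l%:num) *: y by [].
  by rewrite !scalerBr addrACA -opprD -scalerDl [l%:num + _]addrC subrK scale1r.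
have l0 : 0 <= l%:num by [].
have l1 : 0 <= 1 - l%:num by rewrite subr_ge0.
rewrite (le_trans (ler_normD _ _))// !normrZ !ger0_norm//.
have := ler_wpM2l l0 xa; have := ler_wpM2l l1 ya; lra.
Qed.

(** Outside a cube containing the grid the extended error is the distance. *)
Lemma ext_dual_error_out G a r x xi : {in G, forall y, cube a r y} ->
  ~ cube a r xi -> x \in G -> (ext_dual_error N p G xi <= (N (xi - x))%:E)%E.
Proof.
move=> Ga xia xG; rewrite /ext_dual_error; case: ifPn => [/asboolP h|_].
  by exfalso; apply: xia; apply: h; [exact: cube_convex|move=> y /= /Ga].
exact: dist_grid_le.
Qed.

End DualError.

(** * Multilinear interpolation on regular grids *)

Section Multilinear.
Context {R : realType} {d : nat}.
Implicit Types (t : 'I_d -> R) (b : {ffun 'I_d -> bool}).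

(** The multilinear interpolation weight of the vertex [b] of the unit cube at
    the point [t]. *)
Definition vertex_weight t b : R := \prod_i (if b i then t i else 1 - t i).

Lemma vertex_weight_ge0 t b : (forall i, 0 <= t i <= 1) -> 0 <= vertex_weight t b.
Proof.
move=> ht; apply: prodr_ge0 => i _; have /andP[t0 t1] := ht i.
by case: ifP => _; rewrite ?subr_ge0.
Qed.

Lemma sum_vertex_weight t : \sum_b vertex_weight t b = 1.
Proof.
rewrite /vertex_weight.
rewrite -(bigA_distr_bigA (fun i (c : bool) => if c then t i else 1 - t i))/=.
by apply: big1 => i _; rewrite big_bool/= addrC subrK.
Qed.

(** The mean of the vertices of the unit cube, weighted at [t], is [t]. *)
Lemma sum_vertex_weight_coord t i :
  \sum_b vertex_weight t b * (b i)%:R = t i.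
Proof.
(* The factor [b i] is absorbed into the [i]-th factor of the product. *)
pose g j (c : bool) := (if c then t j else 1 - t j) * (if j == i then c%:R else 1).
transitivity (\sum_(b : {ffun 'I_d -> bool}) \prod_j g j (b j)).
  apply: eq_bigr => b _; rewrite big_split/=; congr (_ * _).
  by rewrite -big_mkcond/= big_pred1_eq.
rewrite -bigA_distr_bigA/=.
transitivity (\prod_j (if j == i then t i else 1)); last first.
  by rewrite -big_mkcond/= big_pred1_eq.
apply: eq_bigr => j _; rewrite big_bool/= /g; case: eqP => [->|_].
  by rewrite mulr1 mulr0 addr0.
by rewrite !mulr1 addrC subrK.
Qed.

End Multilinear.

Section fset_family.
Context {I : finType} {K : choiceType}.

(** The finite set of values of a finite family. *)
Definition family_fset (v : I -> K) : {fset K} := [fset v i | i in I]%fset.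

Lemma family_fset_in (v : I -> K) i : v i \in family_fset v.
Proof. by apply/imfsetP; exists i. Qed.

Lemma family_fsetP (v : I -> K) y : y \in family_fset v -> exists i, y = v i.
Proof. by move=> /imfsetP[i _ ->]; exists i. Qed.

Lemma card_family_fset (v : I -> K) : (#|` family_fset v| <= #|I|)%N.
Proof. by rewrite (leq_trans (leq_imfset_card _ _ _))// cardE. Qed.

End fset_family.

Lemma family_fset_grids (I : finType) (R : realType) (d n : nat)
    (v : I -> 'rV[R]_d) (i : I) :
  (#|I| <= n)%N -> grids n (family_fset v).
Proof.
move=> In; split; last exact: leq_trans (card_family_fset _) In.
by apply/fset0Pn; exists (v i); exact: family_fset_in.
Qed.

Section CubeGrid.
Context {R : realType} {d : nat}.
Implicit Types (a x : 'rV[R]_d) (r : R).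

(** The right end point [L] is put in the last cell, so that the upper vertices
    of a cell are always nodes of the grid. *)
Lemma cell_index (s : R) (L : nat) : (0 < L)%N -> 0 <= s <= L%:R ->
  exists z : nat, (z < L)%N /\ 0 <= s - z%:R <= 1.
Proof.
elim: L => [//|[_ _|L IH _] /andP[s0 sL]].
  by exists 0%N; split => //; rewrite subr0 s0.
have [sL1|sL1] := leP s L.+1%:R.
  have [|z [zL hz]] := IH isT; first by rewrite s0.
  by exists z; split => //; exact: ltnW.
exists L.+1; split => //; rewrite subr_ge0 ltW//= lerBlDl -[X in _ + X]/(1%:R).
by rewrite -natrD addn1.
Qed.

(** The nodes of the regular grid of the cube of center [a] and half side [r]
    with [L] cells per side. *)
Definition cube_node a r (L : nat) (f : {ffun 'I_d -> 'I_L.+1}) : 'rV[R]_d :=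
  \row_i (a 0 i - r + 2 * r / L%:R * (f i)%:R).

Lemma cube_node_in a r L (f : {ffun 'I_d -> 'I_L.+1}) : 0 <= r -> (0 < L)%N ->
  cube a r (cube_node a r f).
Proof.
move=> r0 L0; apply/rV_norm_le => // i; rewrite !mxE.
have L0' : 0 < L%:R :> R by rewrite ltr0n.
have f0 : 0 <= (f i)%:R :> R by rewrite ler0n.
have f1 : (f i)%:R / L%:R <= 1 :> R by rewrite ler_pdivrMr// mul1r ler_nat -ltnS.
have f2 : 0 <= (f i)%:R / L%:R :> R by rewrite divr_ge0 ?ler0n.
have := ler_wpM2l r0 f1; have := mulr_ge0 r0 f2.
set q := (f i)%:R / L%:R; rewrite -mulrA [_^-1 * _]mulrC -/q => h1 h2.
by rewrite ler_norml; apply/andP; split; lra.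
Qed.

(** Multilinear interpolation in the cell of the grid which contains [x]. *)
Lemma cube_node_barycenter a r L x : 0 < r -> (0 < L)%N -> cube a r x ->
  exists (v : {ffun 'I_d -> bool} -> {ffun 'I_d -> 'I_L.+1})
         (w : {ffun 'I_d -> bool} -> R),
    [/\ forall b, 0 <= w b, \sum_b w b = 1,
        \sum_b w b *: cube_node a r (v b) = x &
        forall b, `|x - cube_node a r (v b)| <= 2 * r / L%:R].
Proof.
move=> r0 L0 xa; set h := 2 * r / L%:R.
have L0' : 0 < L%:R :> R by rewrite ltr0n.
have h0 : 0 < h by rewrite divr_gt0// mulr_gt0.
(* The coordinates of [x] in the frame of the cube, in units of cells. *)
pose s i := (x 0 i - a 0 i + r) / h.
have hL : h * L%:R = 2 * r by rewrite /h mulfVK// gt_eqF.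
have /choice[z hz] : forall i, exists z : nat, (z < L)%N /\ 0 <= s i - z%:R <= 1.
  move=> i; apply: cell_index => //.
  have := le_trans (rV_coord_le (x - a) i) xa.
  rewrite !mxE ler_norml => /andP[h1 h2].
  by rewrite divr_ge0 ?(ltW h0)//=; [rewrite ler_pdivrMr// mulrC hL; lra|lra].
pose t i := s i - (z i)%:R.
exists (fun b : {ffun 'I_d -> bool} => [ffun i => inord (z i + b i)]).
exists (vertex_weight t).
have node (b : {ffun 'I_d -> bool}) i :
    cube_node a r [ffun i => inord (z i + b i) : 'I_L.+1] 0 i =
     a 0 i - r + h * (z i)%:R + h * (b i)%:R.
  rewrite mxE ffunE inordK ?natrD ?mulrDr ?addrA//.
  by have [+ _] := hz i; case: (b i) => /=; lia.
have xE i : x 0 i = a 0 i - r + h * (z i)%:R + h * t i.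
  have : h * s i = x 0 i - a 0 i + r by rewrite /s mulrC divfK ?gt_eqF.
  by rewrite /t mulrBr; lra.
split.
- by move=> b; apply: vertex_weight_ge0 => i; have [] := hz i.
- exact: sum_vertex_weight.
- apply/rowP => i; rewrite summxE xE.
  under eq_bigr => b _ do rewrite mxE node mulrDr [X in _ + X]mulrCA.
  rewrite big_split/= -mulr_suml sum_vertex_weight mul1r -mulr_sumr.
  by rewrite sum_vertex_weight_coord.
- move=> b; apply/rV_norm_le; first exact: ltW.
  move=> i; rewrite mxE [X in _ + X]mxE node xE opprD addrACA subrr add0r.
  rewrite -mulrBr normrM gtr0_norm// -[leRHS]mulr1 ler_pM2l//.
  have [_] := hz i; rewrite -/(t i) => /andP[t0 t1].
  by case: (b i); rewrite ler_norml; apply/andP; split => /=; lra.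
Qed.

End CubeGrid.

(** * Layered grids *)

(** The largest power of two allowed by a budget of [n] points is at least a
    constant times [n^(1/d)]. *)
Lemma dyadic_budget (R : realType) (d n : nat) : (0 < d)%N -> (4 ^ d <= n)%N ->
  exists J : nat, ((4 * 2 ^ J) ^ d <= n)%N /\
    (2 ^ J)%:R^-1 <= 8 * n%:R `^ (- d%:R^-1) :> R.
Proof.
move=> d0 n4.
pose Q J := ((4 * 2 ^ J) ^ d <= n)%N.
have Q0 : exists J, Q J by exists 0%N; rewrite /Q expn0 muln1.
have Qn J : Q J -> (J <= n)%N.
  move=> /(leq_trans _); apply; rewrite -(prednK d0) expnS.
  apply: leq_trans (leq_pmulr _ _); last by rewrite expn_gt0 muln_gt0 expn_gt0.
  by rewrite (leq_trans (ltnW (ltn_expl J (isT : 1 < 2)%N)))// leq_pmull.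
case: (ex_maxnP Q0 Qn) => J QJ maxJ; exists J; split => //.
have n0 : (0 < n)%N by apply: leq_trans n4; rewrite expn_gt0.
have nJ : (n <= (8 * 2 ^ J) ^ d)%N.
  rewrite leqNgt; apply/negP => h; have := maxJ J.+1; rewrite /Q ltnn => H.
  apply: notF; apply: H; rewrite expnS mulnA; exact: ltnW.
have J0 : 0 < 8 * (2 ^ J)%:R :> R by rewrite mulr_gt0// ltr0n expn_gt0.
have nd0 : 0 < n%:R `^ (d%:R^-1) :> R by rewrite powR_gt0// ltr0n.
rewrite powRN -ler_pdivrMl// -invfM lef_pV2 ?posrE//.
have -> : 8 * (2 ^ J)%:R = (((8 * 2 ^ J) ^ d)%:R) `^ (d%:R^-1) :> R.
  rewrite [X in X `^ _]natrX -powR_mulrn ?ler0n// -powRrM divff ?pnatr_eq0 -?lt0n//.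
  by rewrite powRr1 ?ler0n// natrM.
by rewrite ge0_ler_powR ?invr_ge0 ?nnegrE ?ler0n// ler_nat.
Qed.

(** A point at relative distance [t] from the center lies in the innermost cube,
    between two consecutive ones, or outside all of them. *)
Lemma dyadic_shell (R : realType) (e t : R) (J : nat) :
  [\/ t <= 1,
      exists2 j, (j < J)%N & 2 `^ (j%:R / e) < t <= 2 `^ (j.+1%:R / e) |
      2 `^ (J%:R / e) < t].
Proof.
have [t1|t1] := leP t 1; first by constructor 1.
elim: J => [|J [h|[j jJ h]|h]].
- by constructor 3; rewrite mul0r powRr0.
- by constructor 1.
- by constructor 2; exists j => //; exact: ltnW.
have [tJ|tJ] := leP t (2 `^ (J.+1%:R / e)); last by constructor 3.
by constructor 2; exists J => //; rewrite h.
Qed.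

Section LayeredGrid.
Context {R : realType} {d : nat} {N : 'rV[R]_d -> R} (hN : is_norm N).
Variables (p : R) (hp : 0 < p) (hd : (0 < d)%N).
Variables (e : R) (e0 : 0 < e) (a : 'rV[R]_d) (s : R) (s0 : 0 < s) (J : nat).

(** The layers are cubes with the same center and geometrically growing sides:
    layer [j <= J] has half side [s 2^(j/e)] and [2^(J-j)] cells per side. *)
Definition layer_radius (j : nat) : R := s * 2 `^ (j%:R / e).

(** A node is a layer together with a node of the regular grid of that layer. *)
Definition layer_index := {j : 'I_J.+1 & {ffun 'I_d -> 'I_(2 ^ (J - j)).+1}}.

Definition layer_node (u : layer_index) : 'rV[R]_d :=
  cube_node a (layer_radius (tag u)) (tagged u).

(** The union of the grids of all the layers. *)
Definition layered_grid : {fset 'rV[R]_d} := family_fset layer_node.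

(** The layers have at most [(2 2^(J-j))^d] nodes each, a geometric sum. *)
Lemma card_layer_index : (#|{: layer_index}| <= (4 * 2 ^ J) ^ d)%N.
Proof.
rewrite card_tagged sumnE big_map big_enum/=.
under eq_bigr do rewrite card_ffun !card_ord.
apply: (@leq_trans (\sum_(j < J.+1) (2 * 2 ^ (J - j)) ^ d)).
  apply: leq_sum => j _.
  by rewrite leq_exp2r// mul2n -addnn -addn1 leq_add2l expn_gt0.
elim: J => [|k IH].
  by rewrite big_ord_recl big_ord0 addn0 subn0 expn0 !muln1 leq_exp2r.
rewrite big_ord_recl subn0.
under eq_bigr do rewrite lift0 subSS.
apply: (@leq_trans (2 * (4 * 2 ^ k) ^ d)).
  by rewrite [leqRHS]mul2n -addnn leq_add// leq_exp2r// expnS mulnA.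
rewrite [in X in (_ <= X)%N]expnS [X in (_ <= X ^ _)%N]mulnCA.
rewrite [X in (_ <= X)%N]expnMn leq_mul//.
by rewrite -{1}(expn1 2) leq_exp2l.
Qed.

Lemma layer_radius_gt0 j : 0 < layer_radius j.
Proof. by rewrite mulr_gt0// powR_gt0. Qed.

Lemma layer_radius_le j k : (j <= k)%N -> layer_radius j <= layer_radius k.
Proof.
move=> jk; rewrite ler_pM2l// ler_powR ?ler1n//.
by rewrite ler_pM2r ?invr_gt0// ler_nat.
Qed.

Lemma layered_grid_cube : {in layered_grid, forall y, cube a (layer_radius J) y}.
Proof.
move=> y /family_fsetP[u ->]; rewrite /cube/=.
apply: le_trans (layer_radius_le (leq_ord (tag u))).
by apply: cube_node_in; rewrite ?ltW ?layer_radius_gt0// expn_gt0.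
Qed.

Context {c : R} (c0 : 0 < c) (Nc : forall x, N x <= c * `|x|).

(** In the cube of layer [j] both errors are bounded by the side of the cells of
    that layer, measured with [N]. *)
Lemma layered_grid_error j x : (j <= J)%N -> cube a (layer_radius j) x ->
  let b := c * (2 * layer_radius j / (2 ^ (J - j))%:R) in
  (dual_error N p layered_grid x <= b%:E)%E /\
  (ext_dual_error N p layered_grid x <= b%:E)%E.
Proof.
move=> jJ xj b.
have L0 : (0 < 2 ^ (J - j))%N by rewrite expn_gt0.
have [v [w [w0 w1 wx hb]]] := cube_node_barycenter (layer_radius_gt0 j) L0 xj.
rewrite -ltnS in jJ.
pose u b : layer_index :=
  Tagged (fun j : 'I_J.+1 => {ffun 'I_d -> 'I_(2 ^ (J - j)).+1})
  (v b : {ffun 'I_d -> 'I_(2 ^ (J - Ordinal jJ)).+1}).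
have uG i : layer_node (u i) \in layered_grid by exact: family_fset_in.
have bN i : N (x - layer_node (u i)) <= b.
  rewrite (le_trans (Nc _))// /b ler_pM2l//; exact: hb.
by split; [exact: (dual_error_le hN hp uG w0 w1 wx bN)
          |exact: (ext_dual_error_le hN hp uG w0 w1 wx bN)].
Qed.

(** Up to a constant, the side of the cells of layer [j + 1] is
    [s 2^(-J) (r / s)^(1 + e)] where [r] is the half side of layer [j], and [r]
    is less than the distance to [a] outside the cube of layer [j]. *)
Lemma layered_grid_ext_error x :
  (ext_dual_error N p layered_grid x <=
   (4 * c * 2 `^ e^-1 * s * (2 ^ J)%:R^-1 * (1 + (`|x - a| / s) `^ (1 + e)))%:E)%E.
Proof.
set t := `|x - a| / s.
have t0 : 0 <= t by rewrite divr_ge0// ltW.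
have ts : `|x - a| = s * t by rewrite mulrC divfK// gt_eqF.
have B0 : 0 < (2 ^ J)%:R^-1 :> R by rewrite invr_gt0 ltr0n expn_gt0.
have E1 : 1 <= 2 `^ e^-1 :> R.
  by rewrite -[leLHS](powRr0 2) ler_powR ?ler1n// invr_ge0 ltW.
have te0 : 0 <= t `^ (1 + e) by exact: powR_ge0.
have pe j : (2 `^ (j%:R / e)) `^ e = (2 ^ j)%:R :> R.
  by rewrite -powRrM divfK ?gt_eqF// powR_mulrn// natrX.
have teE : t `^ (1 + e) = t * t `^ e.
  by rewrite powRD ?powRr1// gt_eqF// addr_gt0.
set K := c * s * (2 ^ J)%:R^-1.
have K0 : 0 < K by rewrite !mulr_gt0.
have -> : 4 * c * 2 `^ e^-1 * s / (2 ^ J)%:R * (1 + t `^ (1 + e))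
    = K * (4 * (2 `^ e^-1 * (1 + t `^ (1 + e)))) by rewrite /K; ring.
have [t1|[j jJ /andP[tj tj1]]|tJ] := dyadic_shell e t J.
(* The innermost cube. *)
- have xj : cube a (layer_radius 0) x.
    by rewrite /cube/= /layer_radius mul0r powRr0 ts ler_pM2l.
  have [_ /le_trans] := layered_grid_error (leq0n J) xj; apply; rewrite lee_fin.
  rewrite /layer_radius mul0r powRr0 subn0 mulr1.
  have -> : c * (2 * s / (2 ^ J)%:R) = K * 2 by rewrite /K; ring.
  rewrite ler_pM2l//; have : 1 * 1 <= 2 `^ e^-1 * (1 + t `^ (1 + e)).
    by apply: ler_pM => //; rewrite lerDl.
  lra.
(* Between the cubes of layers [j] and [j + 1]. *)
- have xj : cube a (layer_radius j.+1) x by rewrite /cube/= ts ler_pM2l.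
  have [_ /le_trans] := layered_grid_error jJ xj; apply; rewrite lee_fin.
  have JE : ((2 ^ (J - j.+1))%:R)^-1 = 2 * (2 ^ j)%:R * (2 ^ J)%:R^-1 :> R.
    have -> : (2 ^ J)%:R = 2 * (2 ^ j)%:R * (2 ^ (J - j.+1))%:R :> R.
      by rewrite -!natrM -expnS -expnD subnKC.
    by rewrite invfM mulrA divff ?mul1r// mulf_neq0// pnatr_eq0// expn_eq0.
  rewrite JE /layer_radius.
  have -> : 2 `^ (j.+1%:R / e) = 2 `^ (j%:R / e) * 2 `^ e^-1 :> R.
    have -> : j.+1%:R / e = j%:R / e + e^-1.
      by rewrite -[j.+1%:R]natr1 mulrDl mul1r.
    by rewrite powRD ?pnatr_eq0 ?implybT.
  have -> : c * (2 * (s * (2 `^ (j%:R / e) * 2 `^ e^-1)) *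
      (2 * (2 ^ j)%:R / (2 ^ J)%:R)) =
      K * (4 * (2 `^ e^-1 * (2 `^ (j%:R / e) * (2 ^ j)%:R))) by rewrite /K; ring.
  rewrite !ler_pM2l ?powR_gt0//.
  rewrite -pe teE ler_wpDl// ler_pM ?powR_ge0 ?(ltW tj)//.
  by rewrite ge0_ler_powR ?nnegrE ?powR_ge0 ?(ltW e0) ?(ltW tj).
(* Outside all the cubes: any node does, as [2^J < t^e]. *)
- have out : ~ cube a (layer_radius J) x.
    by rewrite /cube/= ts /layer_radius ler_pM2l// leNgt tJ.
  have xG : layer_node (Tagged _ (finfun (fun=> ord0) :
      {ffun 'I_d -> 'I_(2 ^ (J - (@ord0 J))).+1})) \in layered_grid.
    exact: family_fset_in.
  apply: (le_trans (ext_dual_error_out layered_grid_cube out xG)).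
  rewrite lee_fin (le_trans (Nc _))//.
  set y := layer_node _ in xG *.
  have ya := layered_grid_cube xG; rewrite /cube/= in ya.
  have xy : `|x - y| <= 2 * (s * t).
    have -> : x - y = (x - a) - (y - a) by rewrite opprB addrA subrK.
    rewrite (le_trans (ler_normB _ _))// ts mulr2n mulrDl mul1r lerD2l.
    by rewrite (le_trans ya)// ler_pM2l// ltW.
  apply: (@le_trans _ _ (c * (2 * (s * t)))); first by rewrite ler_pM2l.
  have tt : (2 ^ J)%:R <= t `^ e.
    by rewrite -pe ge0_ler_powR ?nnegrE ?powR_ge0 ?(ltW e0) ?(ltW tJ).
  have -> : c * (2 * (s * t)) = K * (2 * (1 * (t * (2 ^ J)%:R))).
    by rewrite /K; field; rewrite pnatr_eq0 expn_eq0.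
  rewrite ler_pM2l//; apply: ler_pM => //.
    by rewrite mul1r mulr_ge0// ler0n.
    by rewrite ler_nat.
  apply: ler_pM => //; first by rewrite mulr_ge0// ler0n.
  by rewrite teE ler_wpDl// ler_wpM2l.
Qed.

End LayeredGrid.

(** * Grids of [n] points with error of order [n^(-1/d)] *)

Section Grids.
Context {R : realType} {d : nat} {N : 'rV[R]_d -> R} (hN : is_norm N).
Variables (p : R) (hp : 0 < p) (hd : (0 < d)%N).

Lemma root_budget_ge (n : nat) : (0 < n < 4 ^ d)%N ->
  1 <= 4 * n%:R `^ (- d%:R^-1) :> R.
Proof.
move=> /andP[n0 n4]; rewrite powRN ler_pdivlMr ?powR_gt0 ?ltr0n// mul1r.
have -> : 4 = ((4 ^ d)%:R) `^ (d%:R^-1) :> R.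
  rewrite natrX -powR_mulrn ?ler0n// -powRrM divff ?pnatr_eq0 -?lt0n//.
  by rewrite powRr1 ?ler0n.
by rewrite ge0_ler_powR ?invr_ge0 ?nnegrE ?ler0n// ler_nat ltnW.
Qed.

(** For a large number of points the layered grid serves both purposes: it
    covers R^d with an error growing like a power of the distance to [a], and the
    ball of radius [s] around [a] uniformly. *)
Lemma large_grid (e : R) : 0 < e -> exists2 K : R, 0 < K &
  forall n (a : 'rV[R]_d) s, (4 ^ d <= n)%N -> 0 < s -> exists G,
  [/\ grids n G,
      forall x, (ext_dual_error N p G x <=
         (K * n%:R `^ (- d%:R^-1) * s * (1 + (N (x - a) / s) `^ (1 + e)))%:E)%E &
      forall x, `|x - a| <= s ->
         (dual_error N p G x <= (K * n%:R `^ (- d%:R^-1) * s)%:E)%E].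
Proof.
move=> e0; have [c c0 Nc] := is_norm_le_sup hN.
have [c' c'0 cN] := sup_le_is_norm hN.
set E := 2 `^ e^-1 : R; set M := 1 + c' `^ (1 + e).
have E1 : 1 <= E.
  by rewrite -[leLHS](powRr0 2) ler_powR ?ler1n// invr_ge0 ltW.
have M1 : 1 <= M by rewrite lerDl powR_ge0.
exists (32 * c * E * M).
  by rewrite !mulr_gt0// (lt_le_trans ltr01).
move=> n a s n4 s0; have [J [Jn hJ]] := dyadic_budget R hd n4.
set q := n%:R `^ _ in hJ *.
have q0 : 0 <= q by exact: powR_ge0.
have E0 : 0 <= E by exact: le_trans E1.
exists (layered_grid e a s J); split.
- apply: family_fset_grids; last exact: leq_trans (card_layer_index hd J) Jn.
  exact: (Tagged _ (finfun (fun=> ord0) :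
    {ffun 'I_d -> 'I_(2 ^ (J - (@ord0 J))).+1})).
- move=> x; apply: (le_trans (layered_grid_ext_error hN hp e0 a s0 J c0 Nc x)).
  rewrite lee_fin; set t := `|_| / s; set u := N _ / s.
  have u0 : 0 <= u by rewrite divr_ge0 ?(is_norm_ge0 hN)// ltW.
  have tu : 1 + t `^ (1 + e) <= M * (1 + u `^ (1 + e)).
    have : t `^ (1 + e) <= c' `^ (1 + e) * u `^ (1 + e).
      rewrite -powRM// ?(ltW c'0)//; apply: ge0_ler_powR => //.
      - by rewrite addr_ge0// ltW.
      - by rewrite nnegrE divr_ge0// ltW.
      - by rewrite nnegrE mulr_ge0// ltW.
      - by rewrite mulrA ler_pM2r ?invr_gt0.
    have := powR_ge0 u (1 + e); have := powR_ge0 c' (1 + e).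
    rewrite /M; set A := u `^ _; set B := c' `^ _; set F := t `^ _; nra.
  have -> : 4 * c * E * s / (2 ^ J)%:R * (1 + t `^ (1 + e)) =
     (4 * c * E * s) * ((2 ^ J)%:R^-1 * (1 + t `^ (1 + e))) by ring.
  have -> : 32 * c * E * M * q * s * (1 + u `^ (1 + e)) =
     (4 * c * E * s) * ((8 * q) * (M * (1 + u `^ (1 + e)))) by ring.
  rewrite ler_wpM2l//; first by rewrite !mulr_ge0// ltW.
  by apply: ler_pM => //; rewrite addr_ge0 ?powR_ge0.
- move=> x xs.
  have x0 : cube a (layer_radius e s 0) x.
    by rewrite /cube/= /layer_radius mul0r powRr0 mulr1.
  have [+ _] := layered_grid_error hN hp s0 c0 Nc (leq0n J) x0.
  move=> /le_trans; apply; rewrite lee_fin.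
  rewrite /layer_radius mul0r powRr0 subn0 mulr1.
  have -> : c * (2 * s / (2 ^ J)%:R) = (2 * c * s) * ((2 ^ J)%:R^-1 * 1) by ring.
  have -> : 32 * c * E * M * q * s = (2 * c * s) * ((8 * q) * (2 * (E * M))) by ring.
  rewrite ler_wpM2l//; first by rewrite !mulr_ge0// ltW.
  apply: ler_pM => //.
  have : 1 * 1 <= E * M by apply: ler_pM.
  lra.
Qed.

(** On a one-point grid the extended error is at most the distance to the point,
    on the hull, which is this point, as well as outside. *)
Lemma ext_dual_error1 a x :
  (ext_dual_error N p [fset a]%fset x <= (N (x - a))%:E)%E.
Proof.
have [->|/eqP xa] := eqVneq x a.
  have vG (i : unit) : a \in [fset a]%fset by rewrite inE.
  apply: (@ext_dual_error_le _ _ _ hN _ hp _ (fun=> a) (fun=> 1) _ _ _ vG) => //.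
    by rewrite (bigD1 tt)//= big1 ?addr0//; case.
  by rewrite (bigD1 tt)//= big1 ?addr0 ?scale1r//; case.
apply: (@ext_dual_error_out _ _ _ _ _ a 0).
- by move=> y; rewrite inE => /eqP ->; rewrite /cube/= subrr normr0.
- by rewrite /cube/= normr_le0 subr_eq0 => /eqP.
- by rewrite inE.
Qed.

(** The first bound of [large_grid] for every number of points; when [n < 4^d]
    the grid is the single point [a]. *)
Lemma ext_grid (e : R) : 0 < e -> exists2 K : R, 0 < K &
  forall n (a : 'rV[R]_d) s, (0 < n)%N -> 0 < s -> exists2 G, grids n G &
  forall x, (ext_dual_error N p G x <=
         (K * n%:R `^ (- d%:R^-1) * s * (1 + (N (x - a) / s) `^ (1 + e)))%:E)%E.
Proof.
move=> e0; have [K K0 hK] := large_grid e0.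
exists (K + 4); first by rewrite addr_gt0.
move=> n a s n0 s0.
have q0 : 0 <= n%:R `^ (- d%:R^-1) :> R by exact: powR_ge0.
have [n4|n4] := leqP (4 ^ d) n.
  have [G [Gn hG _]] := hK n a s n4 s0; exists G => // x.
  apply: (le_trans (hG x)); rewrite lee_fin.
  rewrite ler_wpM2r ?addr_ge0 ?powR_ge0// ler_wpM2r ?(ltW s0)// ler_wpM2r//.
  by rewrite lerDl.
exists [fset a]%fset.
  split; last by rewrite cardfs1.
  by apply/fset0Pn; exists a; rewrite inE.
move=> x; apply: (le_trans (ext_dual_error1 a x)); rewrite lee_fin.
have /andP : (0 < n < 4 ^ d)%N by rewrite n0.
move=> /andP/root_budget_ge; set q := n%:R `^ _ => q1.
set t := N _ / s.
have t0 : 0 <= t by rewrite divr_ge0 ?(is_norm_ge0 hN)// ltW.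
have -> : N (x - a) = s * t by rewrite /t mulrC divfK// gt_eqF.
have -> : (K + 4) * q * s * (1 + t `^ (1 + e)) =
  s * (((K + 4) * q) * (1 + t `^ (1 + e))) by ring.
rewrite ler_pM2l// -[leLHS]mul1r; apply: ler_pM => //.
  by rewrite mulrDl ler_wpDl// mulr_ge0// ltW.
have [t1|t1] := leP t 1.
  by rewrite (le_trans t1)// lerDl powR_ge0.
by rewrite ler_wpDl// le1r_powR ?ltW// ltrDl.
Qed.

End Grids.

(** * Small simplices in affine subspaces *)

(** A subspace of R^d has a basis with entries in [-1, 1] whose coordinate
    functionals are ordinary coordinates: normalize a square submatrix of
    maximal determinant to the identity. *)
Lemma bounded_row_basis (R : realFieldType) (m d : nat) (A : 'M[R]_(m, d)) :
  exists (f : 'I_(\rank A) -> 'I_d) (U : 'I_(\rank A) -> 'rV[R]_d),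
    (forall i j, `|U i 0 j| <= 1) /\
    (forall x : 'rV_d, (x <= A)%MS -> x = \sum_i x 0 (f i) *: U i).
Proof.
set k := \rank A; pose C := (row_base A)^T.
have Cfull : row_full C.
  by rewrite /row_full mxrank_tr -/(row_free _) row_base_free.
pose D (g : {ffun 'I_k -> 'I_d}) := rowsub g C.
have [g gmax] : exists g, forall h, `|\det (D h)| <= `|\det (D g)|.
  pose g0 : {ffun 'I_k -> 'I_d} := finfun (fullrankfun Cfull).
  have [g _ hg] := @arg_maxP _ R _ g0 xpredT (fun g => `|\det (D g)|) isT.
  by exists g => h; exact: hg.
have Dg0 : \det (D g) != 0.
  rewrite -normr_gt0; apply: lt_le_trans (gmax (finfun (fullrankfun Cfull))).
  rewrite normr_gt0 -unitfE -unitmxE -row_free_unit.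
  rewrite /D (eq_rowsub (fullrankfun Cfull)); last by move=> i; rewrite ffunE.
  exact: fullrowsub_free.
have Du : D g \in unitmx by rewrite unitmxE unitfE.
(* The columns of [W] are the normalized basis vectors; its square submatrix
   with rows [g] is the identity. *)
pose W := C *m invmx (D g).
have gW : rowsub g W = 1%:M by rewrite -mul_rowsub_mx mulmxV.
exists g, (fun i => \row_j W j i); split=> [i j|x xA].
  rewrite mxE.
  (* Replacing row [i] of the maximal submatrix by row [j] multiplies its
     determinant by [W j i]. *)
  pose h : {ffun 'I_k -> 'I_d} := [ffun l => if l == i then j else g l].
  pose M := rowsub h W.
  have DM : D h = M *m D g by rewrite mul_rowsub_mx mulmxKV.
  have detM : \det M = W j i.
    rewrite (expand_det_col _ i) (bigD1 i)//= big1 ?addr0 => [|l li].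
      rewrite /M !mxE ffunE eqxx /cofactor addnn -signr_odd odd_double mul1r.
      suff -> : row' i (col' i (rowsub h W)) = 1%:M by rewrite det1 mulr1.
      apply/matrixP => u v; rewrite !mxE ffunE eq_sym (negPf (neq_lift _ _)).
      have /matrixP/(_ (lift i u) (lift i v)) := gW; rewrite !mxE => ->.
      by rewrite (inj_eq (@lift_inj _ i)).
    rewrite /M !mxE ffunE (negPf li).
    have /matrixP/(_ l i) := gW; rewrite !mxE => ->.
    by rewrite (negPf li) mul0r.
  have := gmax h; rewrite DM det_mulmx normrM detM.
  by rewrite ger_pMl// normr_gt0.
have : (x <= row_base A)%MS by rewrite eq_row_base.
move=> /submxP[c xE]; apply/rowP => j.
have xT : x^T = W *m rowsub g x^T.
  by rewrite xE trmx_mul -/C -mul_rowsub_mx -/(D g) mulmxA mulmxKV.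
have /matrixP/(_ j 0) := xT; rewrite !mxE => ->.
rewrite summxE; apply: eq_bigr => i _; by rewrite !mxE mulrC.
Qed.

Section Simplex.
Context {R : realType} {d : nat} {N : 'rV[R]_d -> R} (hN : is_norm N).
Context {p : R} (hp : 0 < p) (hd : (0 < d)%N).
Context {c : R} (c0 : 0 < c) (Nc : forall x, N x <= c * `|x|).

(** A simplex of size comparable with [r] which contains the points of the cube
    of half side [r] lying in an affine subspace. *)
Lemma simplex_grid n k (f : 'I_k -> 'I_d) (U : 'I_k -> 'rV[R]_d)
    (a : 'rV[R]_d) (r : R) :
  (k < n)%N -> (k <= d)%N -> 0 < r -> (forall i j, `|U i 0 j| <= 1) ->
  exists2 G, grids n G &
  forall x, `|x - a| <= r -> x - a = \sum_i (x - a) 0 (f i) *: U i ->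
  (dual_error N p G x <= (c * (4 * d%:R * r))%:E)%E.
Proof.
move=> kn kd r0 U1.
(* The points in question lie in the box [a + sum_i c_i U i] with [|c_i| <= r].
   The simplex has a vertex at the lowest corner [v0] of this box, from which its
   edges [2 k r U i] start; for [k = 0] it is the point [a]. *)
pose v0 := a - r *: \sum_i U i.
pose v (i : 'I_k.+1) :=
  if unlift ord0 i is Some j then v0 + (2 * k%:R * r) *: U j else v0.
exists (family_fset v); first by apply: (family_fset_grids v ord0); rewrite card_ord.
move=> x xr xU.
have vG i : v i \in family_fset v by exact: family_fset_in.
pose y (i : 'I_k) : R := (x - a) 0 (f i).
have yr i : `|y i| <= r by exact: le_trans (rV_coord_le _ _) xr.
pose w1 j := (y j + r) / (2 * k%:R * r).
pose w (i : 'I_k.+1) := if unlift ord0 i is Some j then w1 j else 1 - \sum_j w1 j.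
have w0E : w ord0 = 1 - \sum_j w1 j by rewrite /w unlift_none.
have wE j : w (lift ord0 j) = w1 j by rewrite /w liftK.
have w1_ge0 j : 0 <= w1 j.
  have := yr j; rewrite ler_norml => /andP[h1 h2].
  by rewrite divr_ge0 ?mulr_ge0 ?(ltW r0) ?ler0n//; lra.
have w1_le j : w1 j <= k%:R^-1.
  have k0 : 0 < k%:R :> R by rewrite ltr0n (leq_ltn_trans _ (ltn_ord j)).
  rewrite ler_pdivrMr ?mulr_gt0//.
  have -> : k%:R^-1 * (2 * k%:R * r) = 2 * r by field; rewrite gt_eqF.
  by have := yr j; rewrite ler_norml => /andP[h1 h2]; lra.
have sw1 : \sum_j w1 j <= 1.
  apply: (@le_trans _ _ (\sum_(j < k) k%:R^-1)); first exact: ler_sum.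
  rewrite sumr_const card_ord -[k%:R^-1 *+ k]mulr_natr.
  by have [->|kn0] := eqVneq (k%:R : R) 0; rewrite ?mulr0// mulVf.
have w_ge0 i : 0 <= w i by rewrite /w; case: unliftP => [j|] _ //; rewrite subr_ge0.
have sw : \sum_i w i = 1.
  by rewrite big_ord_recl w0E (eq_bigr w1 (fun i _ => wE i)) subrK.
have sU : `|\sum_i U i| <= k%:R.
  rewrite (le_trans (ler_norm_sum _ _ _))//.
  rewrite -[leRHS](_ : \sum_(i < k) 1 = _); last by rewrite sumr_const card_ord.
  by apply: ler_sum => i _; apply/rV_norm_le.
have d1 : 1 <= d%:R :> R by rewrite ler1n.
have kd' : k%:R <= d%:R :> R by rewrite ler_nat.
have k0' : 0 <= k%:R :> R by rewrite ler0n.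
have xv0 : `|x - v0| <= r + r * k%:R.
  have -> : x - v0 = (x - a) + r *: \sum_i U i by rewrite /v0 opprB addrA addrAC.
  rewrite (le_trans (ler_normD _ _))// lerD// normrZ gtr0_norm//.
  by rewrite ler_pM2l.
have xv i : `|x - v i| <= 4 * d%:R * r.
  rewrite /v; case: unliftP => [j|] _; last by rewrite (le_trans xv0)//; nra.
  rewrite opprD addrA (le_trans (ler_normB _ _))//.
  have : `|(2 * k%:R * r) *: U j| <= 2 * k%:R * r.
    rewrite normrZ ger0_norm ?mulr_ge0 ?(ltW r0)// ler_piMr ?mulr_ge0 ?(ltW r0)//.
    by apply/rV_norm_le.
  move: xv0; nra.
apply: (dual_error_le hN hp vG w_ge0 sw) => [|i]; last first.
  by rewrite (le_trans (Nc _))// ler_pM2l.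
have wvE i : w i *: v i = w i *: v0 +
    if unlift ord0 i is Some j then (y j + r) *: U j else 0.
  rewrite /w /v; case: unliftP => [j|] _; last by rewrite addr0.
  have k0 : 0 < k%:R :> R by rewrite ltr0n (leq_ltn_trans _ (ltn_ord j)).
  by rewrite scalerDr scalerA /w1 divfK// gt_eqF// !mulr_gt0.
under eq_bigr do rewrite wvE.
rewrite big_split/= -scaler_suml sw scale1r big_ord_recl unlift_none add0r.
under eq_bigr do rewrite liftK scalerDl.
rewrite big_split/= -scaler_sumr -xU /v0.
by rewrite [_ + r *: _]addrC addrA subrK addrC subrK.
Qed.

End Simplex.

(** * Bounds on L^p norms without measurability *)

Section LowerIntegral.
Context {R : realType} {disp : measure_display} {T : measurableType disp}.
Local Open Scope ereal_scope.

(** The integral of a nonnegative function is a supremum over simple functions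
    below it, hence monotone without any measurability assumption. *)
Lemma le_lower_integral (mu : {measure set T -> \bar R}) (f g : T -> \bar R) :
  (forall x, 0 <= f x) -> (forall x, f x <= g x) ->
  \int[mu]_x f x <= \int[mu]_x g x.
Proof.
move=> f0 fg.
have g0 x : 0 <= g x by exact: le_trans (fg x).
rewrite !ge0_integralTE//; apply: le_ereal_sup => _ [h hf <-].
by exists h => // x; exact: le_trans (fg x).
Qed.

Variable P : probability T R.

Lemma Lnorm_le_real (p : R) (F : T -> \bar R) (g : T -> \bar R) (B : R) :
  (0 < p)%R -> (0 <= B)%R -> (forall x, 0 <= F x) ->
  (forall x, F x `^ p <= g x) -> \int[P]_x g x <= (B `^ p)%:E ->
  Lnorm P p%:E F <= B%:E.
Proof.
move=> p0 B0 F0 Fg gB; rewrite unlock /=.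
have -> : B%:E = (B `^ p)%:E `^ p^-1.
  by rewrite poweR_EFin -powRrM divff ?gt_eqF// powRr1.
have iF0 : 0 <= \int[P]_x `|F x| `^ p.
  by apply: integral_ge0 => x _; exact: poweR_ge0.
apply: gt0_ler_poweR; rewrite ?invr_ge0 ?(ltW p0)// ?in_itv/= ?andbT ?leey//.
  by rewrite iF0.
  by rewrite lee_fin powR_ge0.
apply: le_trans gB; apply: le_lower_integral => x; first exact: poweR_ge0.
by rewrite gee0_abs.
Qed.

Lemma Lnorm_le_off_null (p : R) (F : T -> \bar R) (A : set T) (B : R) :
  (0 < p)%R -> (0 <= B)%R -> (forall x, 0 <= F x) ->
  measurable A -> P A = 0 -> (forall x, ~ A x -> F x <= B%:E) ->
  Lnorm P p%:E F <= B%:E.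
Proof.
move=> p0 B0 F0 mA PA0 FB.
(* A measurable function above [F ^ p], infinite on [A]. *)
pose g := ((cst +oo : T -> \bar R) \_ A) \+ cst (B `^ p)%:E.
have i0 x : 0 <= ((cst +oo : T -> \bar R) \_ A) x.
  by rewrite patchE; case: ifP => _; rewrite ?leey.
have Bp0 : 0 <= (B `^ p)%:E by rewrite lee_fin powR_ge0.
apply: (@Lnorm_le_real _ _ g) => //.
  move=> x; rewrite /g/= patchE; case: ifPn => [_|]; first by rewrite addye// leey.
  rewrite notin_setE => /FB xB; rewrite add0e -poweR_EFin.
  apply: gt0_ler_poweR; rewrite ?(ltW p0)// ?in_itv/= ?andbT ?leey ?F0//.
  by rewrite lee_fin B0.
rewrite (@ge0_ae_eq_integral _ _ _ P setT g (cst (B `^ p)%:E))//.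
- by rewrite integral_cst// [X in _ * X](_ : _ = 1) ?mule1//; exact: probability_setT.
- apply: emeasurable_funD => //.
  by apply/(measurable_restrictT _ mA).1; exact: measurable_cst.
- by move=> x _; rewrite adde_ge0.
- exists A; split => // x /= /not_implyP[_]; rewrite /g/= patchE.
  by case: ifPn => [/set_mem//|_]; rewrite add0e.
Qed.

Lemma Lnorm_lty_null (p : R) (F : T -> \bar R) (A : set T) :
  (0 < p)%R -> measurable A -> (forall x, A x -> F x = +oo) ->
  Lnorm P p%:E F < +oo -> P A = 0.
Proof.
move=> p0 mA FA; rewrite unlock /=.
have pi0 : (p^-1 != 0)%R by rewrite invr_neq0// gt_eqF.
move=> /(lty_poweRy pi0) h.
apply/eqP/negPn/negP => PA0.
suff : +oo <= \int[P]_x `|F x| `^ p by rewrite leNgt h.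
have <- : \int[P]_(x in A) (cst +oo) x = +oo :> \bar R.
  rewrite integral_cst// gt0_mulye// lt0e PA0/=; exact: measure_ge0.
rewrite integral_mkcond; apply: le_lower_integral => x.
  by rewrite patchE; case: ifP => _; rewrite ?leey.
rewrite patchE; case: ifPn => [/set_mem xA|_]; last exact: poweR_ge0.
by rewrite FA//= gt_eqF.
Qed.

End LowerIntegral.

(** * The support of a law *)

Section Borel.
Context {R : realType} {d : nat}.

Lemma open_measurable_rV (U : set 'rV[R]_d) : open U ->
  measurable (U : set (borel_rV R d)).
Proof. by move=> oU; exact: sub_sigma_algebra. Qed.

Lemma continuous_measurable_rV (f : 'rV[R]_d -> R) : continuous f ->
  measurable_fun setT (f : borel_rV R d -> R).
Proof.
move=> /continuousP cf; apply: (measurability _ (RGenOpens.measurableE R)).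
move=> _ [_ [a [b ->] <-]]; rewrite setTI; apply: open_measurable_rV.
exact/cf/interval_open.
Qed.

Variable mu : probability (borel_rV R d) R.

(** A countable union of compact sets missing the support is negligible: each
    of them is covered by finitely many negligible open sets. *)
Lemma supp_sigma_compact_null (K : nat -> set 'rV[R]_d) :
  (forall k, compact (K k)) -> (forall k x, K k x -> ~ supp mu x) ->
  exists A : set (borel_rV R d),
    [/\ measurable A, mu A = 0 & \bigcup_k K k `<=` A].
Proof.
move=> cK Ksupp.
have nullK k : mu.-negligible (K k : set (borel_rV R d)).
  have := cK k; rewrite compact_cover => cc.
  pose f (U : set 'rV[R]_d) := U.
  have [||D DU KD] := cc _ [set U : set 'rV[R]_d | open U /\ mu U = 0] f.
  - by move=> U [].
  - move=> x /Ksupp; rewrite /supp/= => /existsNP[U /not_implyP[oU /not_implyP[Ux]]].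
    move/negP; rewrite -leNgt => mU; exists U => //; split => //.
    by apply/eqP; rewrite eq_le mU measure_ge0.
  - apply: (@negligibleS _ (borel_rV R d) _ mu _ _ KD).
    rewrite /cover bigcup_fset big_seq.
    elim/big_ind : _ => [|A B nA nB|U UD].
    + exact: negligible_set0.
    + exact: negligibleU.
    + have /set_mem [oU mU] := DU _ UD.
      by apply/negligibleP => //; exact: open_measurable_rV.
have /negligible_bigcup [A [mA muA KA]] :
  forall k, mu.-negligible (K k : set (borel_rV R d)) by exact: nullK.
by exists A.
Qed.

Lemma closed_ball_shell_compact (a : 'rV[R]_d) (r t : R) :
  compact [set x : 'rV[R]_d | r <= `|x - a| <= t].
Proof.
have ca : continuous (fun x : 'rV[R]_d => `|x - a|).
  move=> x; apply: (@cvg_norm _ _ _ (nbhs x) (nbhs_filter x)).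
  apply: (@cvgB _ _ _ (nbhs x) (nbhs_filter x)); first exact: cvg_id.
  exact: cvg_cst.
apply: bounded_closed_compact.
  exists (t + `|a|); split; first exact: num_real.
  move=> M tM x /= /andP[_ xt].
  rewrite -(subrK a x) (le_trans (ler_normD _ _))// ltW//.
  by apply: le_lt_trans tM; rewrite lerD2r.
have -> : [set x : 'rV[R]_d | r <= `|x - a| <= t] =
    (fun x : 'rV[R]_d => `|x - a|) @^-1` `[r, t].
  by apply/seteqP; split => x /=; rewrite in_itv.
by apply: closed_comp => [x _|]; [exact: ca|exact: interval_closed].
Qed.

Lemma supp_nonempty : supp mu !=set0.
Proof.
apply/set0P/negP => /eqP s0.
have [||A [mA muA KA]] :=
    @supp_sigma_compact_null (fun k => [set x : 'rV[R]_d | 0 <= `|x - 0| <= k%:R]).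
- by move=> k; exact: closed_ball_shell_compact.
- by move=> k x _; rewrite s0.
have : mu setT = 0%E.
  apply: subset_measure0 muA => // x _; apply: KA.
  exists (Num.truncn `|x|).+1 => //=; rewrite subr0 normr_ge0/=.
  by rewrite ltW// truncnS_gt.
by rewrite probability_setT => /eqP; rewrite onee_eq0.
Qed.

(** The complement of a closed ball is the union of the compact shells
    [r + 1/(k+1) <= |x - a| <= k]. *)
Lemma supp_ball_null (a : 'rV[R]_d) (r : R) :
  (forall x, supp mu x -> `|x - a| <= r) ->
  exists A : set (borel_rV R d),
    [/\ measurable A, mu A = 0%E & forall x, ~ A x -> `|x - a| <= r].
Proof.
move=> hr.
have [||A [mA muA KA]] :=
    @supp_sigma_compact_null
      (fun k => [set x : 'rV[R]_d | r + k.+1%:R^-1 <= `|x - a| <= k%:R]).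
- by move=> k; exact: closed_ball_shell_compact.
- move=> k x /= /andP[h _] /hr; apply/negP; rewrite -ltNge.
  by apply: lt_le_trans h; rewrite ltrDl invr_gt0.
exists A; split => // x; apply: contra_notP => /negP; rewrite -ltNge => rx.
apply: KA.
pose k := maxn (Num.truncn `|x - a|).+1 (Num.truncn (`|x - a| - r)^-1).+1.
exists k => //=; apply/andP; split.
  rewrite -lerBrDl -[leRHS]invrK lef_pV2 ?posrE ?invr_gt0 ?subr_gt0//.
  apply: (le_trans (ltW (truncnS_gt _))); rewrite ler_nat.
  by rewrite (leq_trans (leq_maxr _ _) (leqnSn k)).
apply: (le_trans (ltW (truncnS_gt _))); rewrite ler_nat; exact: leq_maxl.
Qed.

End Borel.

(** * The extended error: part (a) *)

(** A linear bound valid for every real above [x] passes to [x] itself; this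
    makes it unnecessary to treat degenerate (null or infinite) [x] apart. *)
Lemma lee_mul_of_gt (R : realType) (x m : \bar R) (C k : R) :
  (0 <= x)%E -> 0 < C -> 0 < k ->
  (forall s : R, (x < s%:E)%E -> (m <= (C * k * s)%:E)%E) ->
  (m <= C%:E * x * k%:E)%E.
Proof.
move=> x0 C0 k0 h; case: x x0 h => [x|_ _|//].
  rewrite lee_fin => x0 h; apply/lee_addgt0Pr => e e0.
  have Ck : 0 < C * k by rewrite mulr_gt0.
  have := h (x + e / (C * k)); rewrite lte_fin ltrDl divr_gt0// => /(_ isT).
  move=> /le_trans; apply.
  by rewrite -!EFinM -EFinD lee_fin mulrDr mulrCA divff ?gt_eqF// mulr1 mulrAC.
by rewrite gt0_muley ?lte_fin// gt0_mulye ?lte_fin// leey.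
Qed.

Lemma powR_1D_le (R : realType) (p u : R) : 0 < p -> 0 <= u ->
  (1 + u) `^ p <= 2 `^ p * (1 + u `^ p).
Proof.
move=> p0 u0.
have [u1|u1] := leP u 1.
  rewrite -[leLHS]mulr1; apply: ler_pM; rewrite ?powR_ge0// ?lerDl ?powR_ge0//.
  by rewrite ge0_ler_powR ?nnegrE ?(ltW p0)// ?addr_ge0//; lra.
apply: (@le_trans _ _ ((2 * u) `^ p)).
  by rewrite ge0_ler_powR ?nnegrE ?(ltW p0)// ?addr_ge0// ?mulr_ge0//; lra.
by rewrite powRM// ler_wpM2l ?powR_ge0// lerDr.
Qed.

Section MeanExtError.
Context {R : realType} {d : nat} {N : 'rV[R]_d -> R} (hN : is_norm N).
Context {disp : measure_display} {T : measurableType disp} (P : probability T R)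
  (X : {RV P >-> borel_rV R d}).

Lemma measurable_RV_comp (f : 'rV[R]_d -> R) : continuous f ->
  measurable_fun setT (fun w => f (X w)).
Proof.
move=> cf; apply: (measurableT_comp (continuous_measurable_rV cf)).
exact: measurable_funP.
Qed.

Lemma int_powR_le (q s : R) (a : 'rV[R]_d) : 0 < q -> 0 <= s ->
  (Lnorm P q%:E (fun w => (N (X w - a))%:E) <= s%:E)%E ->
  (\int[P]_w (N (X w - a) `^ q)%:E <= (s `^ q)%:E)%E.
Proof.
move=> q0 s0 h.
have -> : (\int[P]_w (N (X w - a) `^ q)%:E)%E =
    (Lnorm P q%:E (fun w => (N (X w - a))%:E) `^ q)%E.
  rewrite poweR_Lnorm ?gt_eqF//; apply: eq_integral => w _.
  by rewrite gee0_abs ?lee_fin ?(is_norm_ge0 hN)// poweR_EFin.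
rewrite -poweR_EFin; apply: gt0_ler_poweR; rewrite ?(ltW q0)//.
  by rewrite in_itv/= Lnorm_ge0 leey.
by rewrite in_itv/= lee_fin s0 leey.
Qed.

Variables (p eta : R) (hp : 0 < p) (heta : 0 < eta).

(** A grid with the pointwise bound of [ext_grid] controls the mean error: as
    [p (1 + eta / p) = p + eta], the bound only involves the [p + eta]-th moment
    around [a], which is at most [s^(p + eta)] for a suitable [a]. *)
Lemma mean_ext_dual_error_le (K : R) (n : nat) (s : R) : 0 < K ->
  (forall (a : 'rV[R]_d), 0 < s -> exists2 G, grids n G &
  forall x, (ext_dual_error N p G x <=
         (K * s * (1 + (N (x - a) / s) `^ (1 + eta / p)))%:E)%E) ->
  (pseudo_std N (p + eta) P X < s%:E)%E ->
  (mean_ext_dual_error N p P X n <= (2 `^ p^-1 * 2 * K * s)%:E)%E.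
Proof.
move=> K0 hG /ereal_inf_lt[_ [a _ <-]] as_.
have q0 : 0 < p + eta by rewrite addr_gt0.
have s0 : 0 < s by rewrite -lte_fin (le_lt_trans _ as_)// Lnorm_ge0.
have hint := int_powR_le q0 (ltW s0) (ltW as_).
have [G Gn GX] := hG a s0.
apply: (@le_trans _ _ (Lnorm P p%:E (fun w => ext_dual_error N p G (X w)))).
  by apply: ereal_inf_lbound; exists G.
set L := K * s in GX.
have L0 : 0 < L by rewrite mulr_gt0.
set c := (2 * L) `^ p; set c' := c * s^-1 `^ (p + eta).
have c0 : 0 <= c by exact: powR_ge0.
have c'0 : 0 <= c' by rewrite mulr_ge0// powR_ge0.
apply: (@Lnorm_le_real _ _ _ _ _ _
  (fun w => c%:E + c'%:E * (N (X w - a) `^ (p + eta))%:E)%E) => //.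
- by rewrite !mulr_ge0 ?powR_ge0// ltW.
- by move=> w; exact: ext_dual_error_ge0.
- move=> w; set t := N (X w - a).
  have t0 : 0 <= t by exact: is_norm_ge0.
  have u0 : 0 <= (t / s) `^ (1 + eta / p) by exact: powR_ge0.
  apply: (@le_trans _ _ ((L * (1 + (t / s) `^ (1 + eta / p)))%:E `^ p)%E).
    apply: gt0_ler_poweR; rewrite ?(ltW hp)//.
      by rewrite in_itv/= (ext_dual_error_ge0 hN) leey.
    by rewrite in_itv/= lee_fin mulr_ge0 ?(ltW L0) ?addr_ge0//= leey.
  rewrite poweR_EFin -EFinM -EFinD lee_fin powRM ?(ltW L0) ?addr_ge0//.
  apply: (@le_trans _ _ (L `^ p * (2 `^ p * (1 + (t / s) `^ (p + eta))))).
    rewrite ler_wpM2l ?powR_ge0// (le_trans (powR_1D_le hp u0))//.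
    by rewrite -powRrM mulrDl mul1r divfK ?gt_eqF.
  rewrite mulrA -powRM ?(ltW L0)// [L * 2]mulrC -/c mulrDr mulr1 /c' lerD2l.
  by rewrite powRM ?invr_ge0 ?(ltW s0)// mulrCA mulrC.
have mN : measurable_fun setT (fun w => (N (X w - a) `^ (p + eta))%:E).
  apply/measurable_EFinP; apply: (measurableT_comp (measurable_powR _)).
  exact: measurable_RV_comp (@is_norm_shift_continuous _ _ _ hN a).
rewrite ge0_integralD//=; last 2 first.
  by move=> w _; rewrite -EFinM lee_fin mulr_ge0// powR_ge0.
  exact: measurable_funeM.
rewrite integral_cst// [X in (_ * X)%E](_ : _ = 1%E); last first.
  exact: probability_setT.
rewrite ge0_integralZl_EFin//=; last by move=> w _; rewrite lee_fin powR_ge0.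
apply: (@le_trans _ _ (c%:E * 1 + c'%:E * (s `^ (p + eta))%:E)%E).
  by rewrite leeD2l// lee_wpmul2l.
rewrite mule1 -EFinM -EFinD lee_fin /c' -(mulrA c) -powRM ?invr_ge0 ?(ltW s0)//.
rewrite mulVf ?gt_eqF// powR1 mulr1.
rewrite [leRHS](_ : _ = (2 `^ p^-1 * (2 * L)) `^ p); last by rewrite /L !mulrA.
rewrite [leRHS]powRM ?powR_ge0 ?(mulr_ge0 _ (ltW L0))//.
by rewrite -powRrM mulVf ?gt_eqF// powRr1// mulrDl !mul1r.
Qed.

End MeanExtError.

Lemma pseudo_std_ge0 (R : realType) (d : nat) (N : 'rV[R]_d -> R) (q : R)
  (disp : measure_display) (T : measurableType disp) (P : probability T R)
  (X : T -> 'rV[R]_d) : (0 <= pseudo_std N q P X)%E.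
Proof. by apply: le_ereal_inf_tmp => _ [a _ <-]; exact: Lnorm_ge0. Qed.

Theorem mean_ext_dual_error_rate (R : realType) (d : nat)
    (N : 'rV[R]_d -> R) (p eta : R) (hd : (1 <= d)%N) (hN : is_norm N)
    (hp : 0 < p) (heta : 0 < eta) :
  exists C : R, 0 < C /\
    forall (disp : measure_display) (T : measurableType disp)
           (P : probability T R) (X : {RV P >-> borel_rV R d}) (n : nat),
      (1 <= n)%N ->
      (mean_ext_dual_error N p P X n
         <= C%:E * pseudo_std N (p + eta) P X * (n%:R `^ (- d%:R^-1))%:E)%E.
Proof.
have [K K0 hK] := ext_grid hN hp hd (divr_gt0 heta hp).
exists (2 `^ p^-1 * 2 * K); split; first by rewrite !mulr_gt0// powR_gt0.
move=> disp T P X n n0.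
have k0 : 0 < n%:R `^ (- d%:R^-1) :> R by rewrite powR_gt0// ltr0n.
apply: lee_mul_of_gt => //; first exact: pseudo_std_ge0.
  by rewrite !mulr_gt0// powR_gt0.
move=> s hs.
have := @mean_ext_dual_error_le R d N hN disp T P X p eta hp heta
  (K * n%:R `^ (- d%:R^-1)) n s (mulr_gt0 K0 k0) _ hs.
rewrite !mulrA; apply => a s0; exact: hK.
Qed.

(** * The dual error: part (b) *)

Section AffineHull.
Context {R : realType} {d : nat}.

(** The points with barycentric weights on a grid of [n] points lie in an affine
    subspace of dimension less than [n], described by a bounded row basis. *)
Lemma grid_affine_hull (G : {fset 'rV[R]_d}) (n : nat) : grids n G ->
  exists (g : 'rV[R]_d) (k : nat) (f : 'I_k -> 'I_d) (U : 'I_k -> 'rV[R]_d),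
    [/\ (k < n)%N, (k <= d)%N, forall i j, `|U i 0 j| <= 1 &
      forall x, bary_weights G x !=set0 ->
        x - g = \sum_i (x - g) 0 (f i) *: U i].
Proof.
move=> [/fset0Pn[g gG] Gn].
pose t : seq 'rV[R]_d := (G `\ g)%fset.
pose A := \matrix_(i < size t) (t`_i - g).
have [f [U [U1 hU]]] := bounded_row_basis A.
exists g, (\rank A), f, U; split => //.
- have := cardfsD1 g G; rewrite gG => cG.
  rewrite cG add1n in Gn; apply: leq_trans Gn; rewrite ltnS; exact: rank_leq_row.
- exact: rank_leq_col.
move=> x [lam [_ lx l1]]; apply: hU.
have -> : x - g = \sum_(y <- G) lam y *: (y - g).
  under eq_bigr do rewrite scalerBr.
  by rewrite sumrB lx -scaler_suml l1 scale1r.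
rewrite big_seq; apply: summx_sub => y yG; apply: scalemx_sub.
have [->|yg] := eqVneq y g; first by rewrite subrr sub0mx.
have yt : y \in t by rewrite /t !inE yg yG.
have it : (index y t < size t)%N by rewrite index_mem.
have -> : y - g = row (Ordinal it) A by rewrite rowK nth_index.
exact: row_sub.
Qed.

(** The affine subspaces above are closed. *)
Lemma affine_hull_open (g : 'rV[R]_d) (k : nat) (f : 'I_k -> 'I_d)
    (U : 'I_k -> 'rV[R]_d) :
  open [set x : 'rV[R]_d | x - g != \sum_i (x - g) 0 (f i) *: U i].
Proof.
(* [|L v| + |v|] is a norm, hence continuous, and so is its first term. *)
pose L (v : 'rV[R]_d) := v - \sum_i v 0 (f i) *: U i.
pose M (v : 'rV[R]_d) := `|L v| + `|v|.
have LD u v : L (u + v) = L u + L v.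
  rewrite /L addrACA -opprD -big_split/=; congr (_ - _); apply: eq_bigr => i _.
  by rewrite mxE scalerDl.
have LZ a v : L (a *: v) = a *: L v.
  rewrite /L scalerBr scaler_sumr; congr (_ - _); apply: eq_bigr => i _.
  by rewrite mxE scalerA.
have normM : is_norm M.
  split.
  - by move=> x y; rewrite /M LD [leRHS]addrACA lerD// ler_normD.
  - by move=> a x; rewrite /M LZ !normrZ mulrDr.
  - move=> x /eqP; rewrite /M paddr_eq0// => /andP[_].
    by rewrite normr_eq0 => /eqP.
have norm1 : is_norm (fun v : 'rV[R]_d => `|v|).
  split; [exact: ler_normD|exact: normrZ|exact: normr0_eq0].
have cL : continuous (fun x : 'rV[R]_d => M (x - g) - `|x - g|).
  move=> x; apply: (@cvgB _ _ _ (nbhs x) (nbhs_filter x)).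
    exact: (@is_norm_shift_continuous _ _ _ normM).
  exact: (@is_norm_shift_continuous _ _ _ norm1).
have -> : [set x : 'rV[R]_d | x - g != \sum_i (x - g) 0 (f i) *: U i] =
    (fun x : 'rV[R]_d => M (x - g) - `|x - g|) @^-1` [set x | x != 0].
  by apply/seteqP; split => x /=; rewrite /M addrK normr_eq0 subr_eq0.
by move/continuousP: cL; apply; exact: open_neq.
Qed.

End AffineHull.

Section MeanDualError.
Context {R : realType} {d : nat} {N : 'rV[R]_d -> R} (hN : is_norm N).
Context {disp : measure_display} {T : measurableType disp} (P : probability T R)
  (X : {RV P >-> borel_rV R d}) (p : R) (hp : 0 < p).

Lemma mean_dual_error_le (n : nat) (G : {fset 'rV[R]_d})
    (A : set (borel_rV R d)) (B : R) :
  grids n G -> 0 <= B -> measurable A -> distribution P X A = 0%E ->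
  (forall x, ~ A x -> (dual_error N p G x <= B%:E)%E) ->
  (mean_dual_error N p P X n <= B%:E)%E.
Proof.
move=> Gn B0 mA A0 hB.
apply: (@le_trans _ _ (Lnorm P p%:E (fun w => dual_error N p G (X w)))).
  by apply: ereal_inf_lbound; exists G.
apply: (@Lnorm_le_off_null _ _ _ _ _ _ (X @^-1` A)) => //.
- by move=> w; exact: dual_error_ge0.
- by rewrite -[_ @^-1` _]setTI; exact: measurable_funP.
- by move=> w; exact: hB.
Qed.

Lemma dual_error_pinfty (G : {fset 'rV[R]_d}) x :
  ~ (bary_weights G x !=set0) -> dual_error N p G x = +oo%E.
Proof.
move=> h; rewrite /dual_error (_ : bary_weights G x = set0) ?image_set0 ?ereal_inf0//.
by apply/eqP/negPn/negP => /set0P.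
Qed.

(** An affine subspace of dimension less than [n] which carries the law of [X]:
    the whole space if [d < n], and otherwise the affine hull of any grid of [n]
    points with finite mean error. *)
Lemma affine_support (n : nat) :
  (d < n)%N \/ (mean_dual_error N p P X n < +oo)%E ->
  exists (k : nat) (f : 'I_k -> 'I_d) (U : 'I_k -> 'rV[R]_d)
    (A : set (borel_rV R d)),
    [/\ (k < n)%N, (k <= d)%N, forall i j, `|U i 0 j| <= 1,
     measurable A /\ distribution P X A = 0%E &
     forall a x, supp (distribution P X) a -> ~ A x ->
       x - a = \sum_i (x - a) 0 (f i) *: U i].
Proof.
move=> [dn|/ereal_inf_lt[_ [G Gn <-] Gfin]].
  exists d, id, (fun i => delta_mx 0 i), set0; split => //.
    move=> i j; rewrite mxE eqxx/=; case: (j == i); by rewrite ?normr1 ?normr0.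
  by move=> a x _ _; exact: row_sum_delta.
have [g [k [f [U [kn kd U1 hU]]]]] := grid_affine_hull Gn.
pose A := [set x : 'rV[R]_d | x - g != \sum_i (x - g) 0 (f i) *: U i].
have oA : open A by exact: affine_hull_open.
have mA : measurable (A : set (borel_rV R d)) by exact: open_measurable_rV.
have A0 : distribution P X A = 0%E.
  apply: (Lnorm_lty_null hp _ _ Gfin).
    by rewrite -[_ @^-1` _]setTI; exact: measurable_funP.
  move=> w /= /eqP Aw; apply: dual_error_pinfty.
  by move/hU.
exists k, f, U, A; split => // a x sa Ax.
have nA y : ~ A y -> y - g = \sum_i (y - g) 0 (f i) *: U i.
  by move=> /negP; rewrite negbK => /eqP.
have Aa : ~ A a by move=> /(sa _ oA); rewrite A0 ltxx.
have -> : x - a = (x - g) - (a - g) by rewrite opprB addrA subrK.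
rewrite {1}(nA _ Ax) {1}(nA _ Aa) -sumrB; apply: eq_bigr => i _.
by rewrite -scalerBl !mxE.
Qed.

End MeanDualError.

Lemma diam_ge0 (R : realType) (d : nat) (N : 'rV[R]_d -> R) (S : set 'rV[R]_d) :
  is_norm N -> S !=set0 -> (0 <= diam N S)%E.
Proof.
move=> hN [a Sa]; apply: ereal_sup_ubound; exists (a, a) => //=.
by rewrite subrr is_norm0.
Qed.

Lemma diam_ge (R : realType) (d : nat) (N : 'rV[R]_d -> R) (S : set 'rV[R]_d) x y :
  S x -> S y -> ((N (x - y))%:E <= diam N S)%E.
Proof. by move=> Sx Sy; apply: ereal_sup_ubound; exists (x, y). Qed.

(** Compactness of the support only serves to make its diameter finite; the bound
    is trivial otherwise. *)
Theorem mean_dual_error_rate (R : realType) (d : nat) (N : 'rV[R]_d -> R) (p : R)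
    (hd : (1 <= d)%N) (hN : is_norm N) (hp : 0 < p) :
  exists C' : R, 0 < C' /\
    forall (disp : measure_display) (T : measurableType disp)
           (P : probability T R) (X : {RV P >-> borel_rV R d}) (n : nat),
      (1 <= n)%N ->
      (d < n)%N \/ (mean_dual_error N p P X n < +oo)%E ->
      (mean_dual_error N p P X n
         <= C'%:E * diam N (supp (distribution P X))
              * (n%:R `^ (- d%:R^-1))%:E)%E.
Proof.
have [K K0 hK] := large_grid hN hp hd ltr01.
have [c c0 Nc] := is_norm_le_sup hN.
have [c' c'0 cN] := sup_le_is_norm hN.
have d0 : 0 < d%:R :> R by rewrite ltr0n.
exists (K * c' + 16 * c * d%:R * c').
split; first by rewrite addr_gt0// !mulr_gt0.
move=> disp T P X n n0 hfin.
set q := n%:R `^ _.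
have q0 : 0 < q by rewrite powR_gt0// ltr0n.
have [a sa] := supp_nonempty (distribution P X).
have D0 : (0 <= diam N (supp (distribution P X)))%E by apply: diam_ge0 => //; exists a.
apply: lee_mul_of_gt => //; first by rewrite addr_gt0// !mulr_gt0.
move=> s Ds.
have s0 : 0 < s by rewrite -lte_fin (le_lt_trans D0).
have r0 : 0 < c' * s by rewrite mulr_gt0.
have [A [mA A0 Ar]] : exists A : set (borel_rV R d), [/\ measurable A,
    distribution P X A = 0%E & forall x, ~ A x -> `|x - a| <= c' * s].
  apply: supp_ball_null => x sx; rewrite (le_trans (cN _))// ler_pM2l//.
  rewrite -lee_fin; apply: le_trans (ltW Ds).
  exact: (diam_ge N (S := supp (distribution P X)) sx sa).
have [n4|n4] := leqP (4 ^ d) n.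
  have [G [Gn _ hG]] := hK n a _ n4 r0.
  have B0 : 0 <= K * q * (c' * s) by rewrite !mulr_ge0// ltW.
  apply: (le_trans (mean_dual_error_le hp Gn B0 mA A0 _)).
    by move=> x /Ar; exact: hG.
  rewrite lee_fin.
  have -> : (K * c' + 16 * c * d%:R * c') * q * s =
     K * q * (c' * s) + 16 * (c * (d%:R * (c' * (q * s)))) by ring.
  by rewrite lerDl !mulr_ge0// ltW.
have [k [f [U [A' [kn kd U1 [mA' A'0] hA']]]]] := affine_support hp hfin.
have [G Gn hG] := simplex_grid hN hp hd c0 Nc f a kn kd r0 U1.
have B0 : 0 <= c * (4 * d%:R * (c' * s)) by rewrite !mulr_ge0// ltW.
apply: (le_trans
  (@mean_dual_error_le _ _ _ _ _ _ X _ hp _ _ (A `|` A') _ Gn B0 _ _ _)).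
- exact: measurableU.
- by rewrite measureU0.
- by move=> x /not_orP[Ax A'x]; apply: hG; [exact: Ar|exact: hA'].
rewrite lee_fin.
have /root_budget_ge : (0 < n < 4 ^ d)%N by rewrite n0.
move=> /(_ R hd); rewrite -/q => q1.
have -> : (K * c' + 16 * c * d%:R * c') * q * s =
     K * (c' * (q * s)) + (c * (4 * d%:R * (c' * s))) * (4 * q) by ring.
rewrite ler_wpDl ?mulr_ge0 ?(ltW s0) ?(ltW q0) ?(ltW c'0) ?(ltW K0)//.
by rewrite ler_peMr.
Qed.

(* In part (b) the bound is claimed for every n >= 1 for which it can hold: a
   finite bound is impossible when the left-hand side is +oo, which for n <= d
   happens unless the support lies in the convex hull of some n points. *)
Theorem proposition2 (R : realType) (d : nat) (N : 'rV[R]_d -> R) (p eta : R)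
    (hd : (1 <= d)%N) (hN : is_norm N) (hp : 0 < p) (heta : 0 < eta) :
  (exists C : R, 0 < C /\
    forall (disp : measure_display) (T : measurableType disp)
           (P : probability T R) (X : {RV P >-> borel_rV R d}) (n : nat),
      (1 <= n)%N ->
      (\int[P]_w ((N (X w) `^ (p + eta))%:E) < +oo)%E ->
      (mean_ext_dual_error N p P X n
         <= C%:E * pseudo_std N (p + eta) P X * (n%:R `^ (- d%:R^-1))%:E)%E)
  /\
  (exists C' : R, 0 < C' /\
    forall (disp : measure_display) (T : measurableType disp)
           (P : probability T R) (X : {RV P >-> borel_rV R d}) (n : nat),
      (1 <= n)%N ->
      compact (supp (distribution P X)) ->
      (d < n)%N \/ (mean_dual_error N p P X n < +oo)%E ->
      (mean_dual_error N p P X n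
         <= C'%:E * diam N (supp (distribution P X))
              * (n%:R `^ (- d%:R^-1))%:E)%E).
Proof.
split.
  have [C [C0 hC]] := mean_ext_dual_error_rate hd hN hp heta.
  by exists C; split => // disp T P X n n0 _; exact: hC.
have [C [C0 hC]] := mean_dual_error_rate hd hN hp.
by exists C; split => // disp T P X n n0 _; exact: hC.
Qed.
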